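(* Let $\mathbb K$ be a field, taken as coefficients, let $X$ be a topological space, let $\mathcal U$ be an open covering of $X$ and let $q\ge 0$. If $z\in H^q_{\mathcal U}(X)$ satisfies $\int_\gamma z=0$ for every $\gamma\in H_q^{\mathcal U}(X)$, then $z=0$ in $H^q_{\mathcal U}(X)$.
   Context: Coefficients are in $\mathbb K$. A formal $q$-simplex is an ordered tuple $\sigma=(x_0\ \ldots\ x_q)$ of points of $X$ (repetitions allowed); it is $\mathcal U$-small if all $x_i$ lie in a common element of $\mathcal U$. $S^{\mathcal U}_q(X)$ is the vector space of finite linear combinations of $\mathcal U$-small formal $q$-simplices, with boundary $\partial(x_0\ \ldots\ x_q)=\sum_{j=0}^q(-1)^j(x_0\ \ldots\ \widehat{x_j}\ \ldots\ x_q)$; $H_q^{\mathcal U}(X)$ is the $q$-th homology of this complex. $C^q(X)$ is the space of all functions $\xi\colon X^{q+1}\to\mathbb K$, with $\delta\xi(x_0,\ldots,x_{q+1})=\sum_{j=0}^{q+1}(-1)^j\xi(x_0,\ldots,\widehat{x_j},\ldots,x_{q+1})$. A cochain is $\mathcal U$-locally zero if it vanishes on all tuples contained in a single member of $\mathcal U$. $H^q_{\mathcal U}(X)$ is the cohomology of the complex $\overline C^*_{\mathcal U}(X)$ of cochains modulo $\mathcal U$-locally zero cochains. For $z\in H^q_{\mathcal U}(X)$ represented by $\xi$ (so $\delta\xi$ is $\mathcal U$-locally zero) and $\gamma\in H_q^{\mathcal U}(X)$ represented by a $\mathcal U$-small cycle $c=\sum k_i\sigma_i$, the integral is $\int_\gamma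 z:=\xi(c):=\sum k_i\xi(\sigma_i)$, where $\xi((x_0\ \ldots\ x_q)):=\xi(x_0,\ldots,x_q)$; it is well defined and bilinear. *)

(* Defs.v *)
From HB Require Import structures.
From mathcomp Require Import all_boot all_algebra.
From mathcomp Require Import all_classical topology.
From mathcomp.multinomials Require Import freeg.

Set Implicit Arguments.
Unset Strict Implicit.
Unset Printing Implicit Defensive.

Import GRing.Theory.

Local Open Scope classical_set_scope.
Local Open Scope ring_scope.
Local Open Scope quotient_scope.

Section QuotientModule.
Variables (R : pzRingType) (V : lmodType R) (I : submodClosed V).

(* submodClosed does not inherit from zmodClosed, which Quotient.quot needs. *)
Definition submod_pred : {pred V} := I.

Lemma submod_pred_zmod_closed : zmod_closed submod_pred.
Proof. exact: GRing.submod_closedB (submodClosedP I). Qed.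
HB.instance Definition _ :=
  GRing.isZmodClosed.Build V submod_pred submod_pred_zmod_closed.

Definition quotmod := Quotient.quot submod_pred.
HB.instance Definition _ : EqQuotient V (Quotient.equiv submod_pred) quotmod :=
  EqQuotient.on quotmod.
HB.instance Definition _ := Choice.on quotmod.
HB.instance Definition _ :=
  ZmodQuotient.copy quotmod (Quotient.quot submod_pred).
Local Notation Q := quotmod.

Definition quot_scale (a : R) : Q -> Q := lift_op1 Q ( *:%R a).

Lemma quotmod_eqP (x y : V) : \pi_Q x = \pi_Q y <-> x - y \in I.
Proof.
rewrite -[x - y \in I]/(x - y \in submod_pred) Quotient.idealrBE.
by split=> [xy|/eqP //]; apply/eqP.
Qed.

Lemma pi_quot_scale a : {morph \pi_Q : x / a *: x >-> quot_scale a x}.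
Proof.
move=> x; unlock quot_scale; apply/quotmod_eqP.
by rewrite -scalerBr rpredZ //; apply/quotmod_eqP; rewrite reprK.
Qed.

Let scaleA a b (x : Q) :
  quot_scale a (quot_scale b x) = quot_scale (a * b) x.
Proof. by rewrite -[x]reprK -!pi_quot_scale scalerA. Qed.

Let scale1 : left_id 1 quot_scale.
Proof. by move=> x; rewrite -[x]reprK -pi_quot_scale scale1r. Qed.

Let scaleDr : right_distributive quot_scale +%R.
Proof.
move=> a x y; rewrite -[x]reprK -[y]reprK -raddfD -!pi_quot_scale.
by rewrite scalerDr raddfD.
Qed.

Let scaleDl (x : Q) : {morph quot_scale^~ x : a b / a + b}.
Proof.
by move=> a b; rewrite -[x]reprK -!pi_quot_scale scalerDl raddfD.
Qed.

HB.instance Definition _ :=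
  GRing.Zmodule_isLmodule.Build R Q scaleA scale1 scaleDr scaleDl.

HB.instance Definition _ :=
  GRing.isScalable.Build R V Q *:%R (\pi_Q : V -> Q) pi_quot_scale.

End QuotientModule.

(* Homology at B of a complex A -f-> B -g-> C: ker g modulo im f. *)
Section Homology.
Variables (R : pzRingType) (A B C : lmodType R).
Variables (f : {linear A -> B}) (g : {linear B -> C}).

Definition cycle_pred : {pred B} := fun x => g x == 0.

Lemma cycle_pred_closed : submod_closed cycle_pred.
Proof.
split=> [|a x y /eqP gx /eqP gy]; first by rewrite unfold_in linear0.
by rewrite unfold_in linearP gx gy scaler0 addr0.
Qed.
HB.instance Definition _ :=
  GRing.isSubmodClosed.Build R B cycle_pred cycle_pred_closed.

Record cycle := Cycle { cycle_val :> B; cycle_valP : cycle_val \in cycle_pred }.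
HB.instance Definition _ := [isSub for cycle_val].
HB.instance Definition _ := [Choice of cycle by <:].
HB.instance Definition _ := [SubChoice_isSubLmodule of cycle by <:].

Definition boundary_pred : {pred cycle} :=
  fun x => `[< exists a : A, f a = cycle_val x >].

Lemma boundary_pred_closed : submod_closed boundary_pred.
Proof.
split=> [|k x y /asboolP[a fa] /asboolP[b fb]]; apply/asboolP.
  by exists 0; rewrite linear0.
by exists (k *: a + b); rewrite linearP fa fb.
Qed.
HB.instance Definition _ :=
  GRing.isSubmodClosed.Build R cycle boundary_pred boundary_pred_closed.

Definition homology := quotmod boundary_pred.
HB.instance Definition _ := GRing.Lmodule.on homology.
HB.instance Definition _ := Quotient.on homology.

End Homology.

Definition open_covering (X : topologicalType) (U : set (set X)) : Prop :=
  U `<=` open /\ cover U id = setT.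

Section Simplices.
Variables (X : choiceType) (U : set (set X)).

Definition simplex (q : nat) := q.+1.-tuple X.

Definition face q (j : 'I_q.+2) (s : simplex q.+1) : simplex q :=
  [tuple tnth s (fintype.lift j i) | i < q.+1].

Definition small q (s : simplex q) : Prop :=
  exists2 A, U A & forall i, A (tnth s i).

Lemma small_face q (j : 'I_q.+2) (s : simplex q.+1) :
  small s -> small (face j s).
Proof. by case=> A UA sA; exists A => // i; rewrite tnth_mktuple. Qed.

Record small_simplex q :=
  SmallSimplex { simplex_of :> simplex q; _ : `[< small simplex_of >] }.
HB.instance Definition _ q := [isSub for @simplex_of q].
HB.instance Definition _ q := [Choice of small_simplex q by <:].

Lemma smallP q (s : small_simplex q) : small s.
Proof. by case: s => s /= /asboolP. Qed.

Definition small_simplex_face q (j : 'I_q.+2) (s : small_simplex q.+1) :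
  small_simplex q := SmallSimplex (introT (asboolP _) (small_face j (smallP s))).

End Simplices.

Section Lift.
Variables (K : fieldType) (T : choiceType) (M : lmodType K) (f : T -> M).

Let fglift_additive : {additive {freeg T / K} -> M} :=
  HB.pack (fglift f : {freeg T / K} -> M)
    (GRing.isZmodMorphism.Build _ _ _ (@lift_is_additive K T M f)).

Lemma fgliftE (c : {freeg T / K}) :
  fglift f c = \sum_(x <- dom c) coeff x c *: f x.
Proof.
rewrite -[in LHS](freeg_sumE c) -[fglift f]/(fglift_additive : _ -> _).
by rewrite raddf_sum; apply: eq_bigr => x _; rewrite /= liftU.
Qed.

Lemma fglift_linear : linear (fglift f : {freeg T / K} -> M).
Proof.
move=> a c d; rewrite -[fglift f]/(fglift_additive : _ -> _) raddfD.
congr +%R => /=; rewrite [in RHS]fgliftE scaler_sumr.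
rewrite -[fglift f]/(fglift_additive : _ -> _) [a *: c]/(fgscale a c).
by rewrite raddf_sum; apply: eq_bigr => x _; rewrite /= liftU scalerA.
Qed.

End Lift.

Section Chains.
Variables (K : fieldType) (X : choiceType) (U : set (set X)).

Definition chain q := {freeg (small_simplex U q) / K}.
HB.instance Definition _ q := GRing.Lmodule.on (chain q).

Definition chain_boundary q : chain q.+1 -> chain q :=
  fglift (fun s => \sum_(j < q.+2) (-1) ^+ j *: << small_simplex_face j s >>).

HB.instance Definition _ q :=
  GRing.isLinear.Build K (chain q.+1) (chain q) *:%R (@chain_boundary q)
    (fglift_linear _).

(* The chain complex is not augmented: it is 0 in degree -1, so the map out of
   degree 0 is zero and its codomain chain 0.-1 is a dummy. *)
Definition chain_out q : {linear chain q -> chain q.-1} :=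
  match q with
  | 0 => \0
  | p.+1 => @chain_boundary p
  end.

Definition small_homology q := homology (@chain_boundary q) (chain_out q).
HB.instance Definition _ q := GRing.Lmodule.on (small_homology q).
HB.instance Definition _ q := Quotient.on (small_homology q).

End Chains.

Section Cochains.
Variables (K : fieldType) (X : choiceType) (U : set (set X)).

Definition cochain q := simplex X q -> K^o.
HB.instance Definition _ q := GRing.Lmodule.on (cochain q).

Definition cochain_coboundary q (xi : cochain q) : cochain q.+1 :=
  fun s => \sum_(j < q.+2) (-1) ^+ j * xi (face j s).

Lemma cochain_coboundary_linear q : linear (@cochain_coboundary q).
Proof.
move=> a xi eta; apply/funext => s.
transitivity (a * cochain_coboundary xi s + cochain_coboundary eta s) => //.
rewrite /cochain_coboundary mulr_sumr -big_split; apply: eq_bigr => j _ /=.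
by rewrite -[(a *: xi + eta) _]/(a * xi _ + eta _) mulrDr mulrCA.
Qed.
HB.instance Definition _ q :=
  GRing.isLinear.Build K (cochain q) (cochain q.+1) *:%R
    (@cochain_coboundary q) (@cochain_coboundary_linear q).

Definition locally_zero q : {pred cochain q} :=
  fun xi => `[< forall s : simplex X q, small U s -> xi s = 0 >].

Lemma locally_zeroP q (xi : cochain q) :
  reflect (forall s, small U s -> xi s = 0) (xi \in @locally_zero q).
Proof. exact: asboolP. Qed.

Lemma locally_zero_closed q : submod_closed (@locally_zero q).
Proof.
split=> [|a xi eta /asboolP xi0 /asboolP eta0]; apply/asboolP => // s Us.
transitivity (a * xi s + eta s) => //.
by rewrite xi0 // eta0 // mulr0 addr0.
Qed.
HB.instance Definition _ q :=
  GRing.isSubmodClosed.Build K (cochain q) (@locally_zero q)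
    (@locally_zero_closed q).

Lemma locally_zero_coboundary q (xi : cochain q) :
  xi \in @locally_zero q -> cochain_coboundary xi \in @locally_zero q.+1.
Proof.
move=> /locally_zeroP xi0; apply/locally_zeroP => s Us.
by apply: big1 => j _; rewrite xi0 ?mulr0 //; exact: small_face.
Qed.

Definition local_cochain q := quotmod (@locally_zero q).
HB.instance Definition _ q := GRing.Lmodule.on (local_cochain q).
HB.instance Definition _ q := Quotient.on (local_cochain q).

Definition local_coboundary q (x : local_cochain q) : local_cochain q.+1 :=
  \pi_(local_cochain q.+1) (cochain_coboundary (repr x)).

Lemma local_coboundary_pi q (xi : cochain q) :
  local_coboundary (\pi_(local_cochain q) xi) =
  \pi_(local_cochain q.+1) (cochain_coboundary xi).
Proof.
apply/quotmod_eqP; rewrite -linearB; apply: locally_zero_coboundary.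
by apply/quotmod_eqP; exact: reprK.
Qed.

Lemma local_coboundary_linear q : linear (@local_coboundary q).
Proof.
move=> a x y; rewrite -[x]reprK -[y]reprK -linearP !local_coboundary_pi.
by rewrite !linearP.
Qed.
HB.instance Definition _ q :=
  GRing.isLinear.Build K (local_cochain q) (local_cochain q.+1) *:%R
    (@local_coboundary q) (@local_coboundary_linear q).

(* Dually, the map into degree 0 is zero, with a dummy domain. *)
Definition local_cochain_in q : {linear local_cochain q.-1 -> local_cochain q} :=
  match q with
  | 0 => \0
  | p.+1 => @local_coboundary p
  end.

Definition local_cohomology q :=
  homology (local_cochain_in q) (@local_coboundary q).
HB.instance Definition _ q := GRing.Lmodule.on (local_cohomology q).
HB.instance Definition _ q := Quotient.on (local_cohomology q).

Definition cochain_eval q (xi : cochain q) (c : chain K U q) : K :=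
  fglift (fun s : small_simplex U q => xi s) c.

Lemma cochain_eval_linear q (xi : cochain q) :
  linear (cochain_eval xi : chain K U q -> K^o).
Proof. exact: fglift_linear. Qed.
HB.instance Definition _ q (xi : cochain q) :=
  GRing.isLinear.Build K (chain K U q) K^o *:%R
    (cochain_eval xi : chain K U q -> K^o) (cochain_eval_linear xi).

Lemma cochain_evalB q (xi eta : cochain q) c :
  cochain_eval (xi - eta) c = cochain_eval xi c - cochain_eval eta c.
Proof.
rewrite /cochain_eval !fgliftE -sumrB.
by apply: eq_bigr => s _; exact: (scalerBr _ (xi s : K^o) (eta s)).
Qed.

Lemma cochain_eval_locally_zero q (xi : cochain q) c :
  xi \in @locally_zero q -> cochain_eval xi c = 0.
Proof.
move=> /locally_zeroP xi0; rewrite /cochain_eval fgliftE big1 // => s _.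
by rewrite xi0 ?scaler0 //; exact: smallP.
Qed.

Lemma cochain_eval_boundary q (xi : cochain q) (c : chain K U q.+1) :
  cochain_eval xi (chain_boundary c) = cochain_eval (cochain_coboundary xi) c.
Proof.
rewrite /chain_boundary fgliftE linear_sum [RHS]/cochain_eval fgliftE.
apply: eq_bigr => s _; rewrite linearZ_LR /= linear_sum; congr (_ * _).
apply: eq_bigr => j _; rewrite linearZ_LR /=; congr (_ * _).
by rewrite /cochain_eval liftU scale1r.
Qed.

(* Computed on representatives chosen by repr; integralE is the independence of
   the choice. *)
Definition integral q (gamma : small_homology K U q) (z : local_cohomology q) :
    K :=
  cochain_eval (repr (cycle_val (repr z))) (cycle_val (repr gamma)).

Lemma integralE q (xi : cochain q) (c : cycle (chain_out K U q))
    (x : cycle (@local_coboundary q)) :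
  cycle_val x = \pi_(local_cochain q) xi ->
  integral (\pi_(small_homology K U q) c) (\pi_(local_cohomology q) x) =
  cochain_eval xi (cycle_val c).
Proof.
move=> xxi; rewrite /integral.
set y := repr (\pi_(local_cohomology q) x).
set d := repr (\pi_(small_homology K U q) c); set zeta := repr (cycle_val y).
have yE : cycle_val y = \pi_(local_cochain q) zeta by rewrite reprK.
have /quotmod_eqP/asboolP[b bE] : \pi_(small_homology K U q) d =
  \pi_(small_homology K U q) c by rewrite reprK.
have /quotmod_eqP/asboolP[w wE] : \pi_(local_cohomology q) y =
  \pi_(local_cohomology q) x by rewrite reprK.
have dzeta : cochain_coboundary zeta \in @locally_zero q.+1.
  have /eqP := cycle_valP y; rewrite yE [X in X = _]local_coboundary_pi.
  by rewrite -(linear0 \pi_(local_cochain q.+1)) => /quotmod_eqP; rewrite subr0.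
transitivity (cochain_eval zeta (cycle_val c)).
  apply/eqP; rewrite -subr_eq0 -linearB -[_ - _]bE.
  by rewrite [X in X == _]cochain_eval_boundary cochain_eval_locally_zero.
apply/eqP; rewrite -subr_eq0 -cochain_evalB; apply/eqP.
have {}wE : local_cochain_in q w = \pi_(local_cochain q) (zeta - xi).
  by transitivity (cycle_val y - cycle_val x); rewrite // yE xxi linearB.
case: q => [|q] in xi c x xxi y d zeta yE b bE w wE dzeta *.
  apply: cochain_eval_locally_zero; rewrite -[_ - _]subr0.
  by apply/quotmod_eqP; rewrite -wE linear0.
have [eta etaE] : exists eta : cochain q,
    local_cochain_in q.+1 w = \pi_(local_cochain q.+1) (cochain_coboundary eta).
  by exists (repr w).
have /(cochain_eval_locally_zero (cycle_val c)) :
    zeta - xi - cochain_coboundary eta \in @locally_zero q.+1.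
  by apply/quotmod_eqP; rewrite -wE etaE.
rewrite (cochain_evalB (_ - _) (cochain_coboundary eta)) => /subr0_eq ->.
rewrite -cochain_eval_boundary.
have /eqP -> : chain_boundary (cycle_val c) == 0 := cycle_valP c.
by rewrite linear0.
Qed.

End Cochains.

(* Main.v *)
From HB Require Import structures.
Require Import Defs.
From mathcomp Require Import all_boot all_algebra.
From mathcomp Require Import all_classical topology.
From mathcomp.multinomials Require Import freeg.

Set Implicit Arguments.
Unset Strict Implicit.
Unset Printing Implicit Defensive.

Import GRing.Theory.

Local Open Scope classical_set_scope.
Local Open Scope ring_scope.
Local Open Scope quotient_scope.

(** Represent [z] by a cochain [xi].  The hypothesis says that [xi], read as a
    linear functional on [U]-small [q]-chains, vanishes on every cycle, that is,
    on the kernel of the boundary map.  Over a field such a functional factors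
    through the boundary map: [xi = h \o boundary] for a linear functional [h]
    on small chains of degree [q-1] ([linear_factor]).  Chains are freely
    generated by small simplices, so [h] amounts to a function on small
    simplices, and extending it by zero to all simplices gives a cochain [eta]
    whose coboundary agrees with [xi] on small simplices.  Hence the class of
    [xi] modulo locally zero cochains is a coboundary.  In degree 0 every
    chain is a cycle, so [xi] itself is locally zero.

    The only point that is not formal is the factorization: the boundary map
    determines [h] on its image, and [h] is extended to all chains by zero on a
    complement of the image.  The complement exists by Zorn's lemma
    ([image_complement]); this is where the coefficients must form a field. *)

Section Factorization.
Variables (K : fieldType) (V W : lmodType K) (f : {linear V -> W}).

(** Zorn's lemma is applied to the sets closed under linear combinations that
    meet the image of [f] at most in 0.  Membership of 0 is not imposed, so that
    the union of the empty chain qualifies; whence the sets [0 |` C] below. *)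
Lemma image_complement :
  exists C : set W,
    [/\ forall a x y, C x -> C y -> C (a *: x + y),
        forall v, C (f v) -> f v = 0
      & forall w, exists v, C (w - f v)].
Proof.
pose P (C : set W) := (forall a x y, C x -> C y -> C (a *: x + y)) /\
  (forall v, C (f v) -> f v = 0).
have [F FP Ftot|C [[Clin Cf] Cmax]] := @Zorn_bigcup W P.
  split=> [a x y [A FA Ax] [B FB By]|v [A FA Av]].
    case: (Ftot _ _ FA FB) => sub.
      by exists B => //; apply: (FP _ FB).1 => //; exact: sub.
    by exists A => //; apply: (FP _ FA).1 => //; exact: sub.
  exact: (FP _ FA).2.
have C0lin a x y : (0 |` C) x -> (0 |` C) y -> (0 |` C) (a *: x + y).
  move=> [->|Cx] [->|Cy].
  - by left; rewrite scaler0 addr0.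
  - by right; rewrite scaler0 add0r.
  - have C0 : C 0 by rewrite -(subrr x) addrC -scaleN1r; exact: Clin.
    by right; exact: Clin.
  - by right; exact: Clin.
have C0f v : (0 |` C) (f v) -> f v = 0 by case=> [//|]; exact: Cf.
have C0 : C 0.
  apply: contrapT => nC0; apply: (Cmax (0 |` C)); last by split.
  by split=> [x|/(_ 0)/(_ (or_introl erefl))]; first by right.
exists C; split=> // w; apply: contrapT => nw.
(* By maximality it is enough that [C + K w] still meets the image trivially:
   a nonzero multiple of [w] in [C + im f] would put [w] there. *)
pose D : set W := [set x | exists a, C (x - a *: w)].
have nDw v a : a != 0 -> ~ C (f v - a *: w).
  move=> a0 Cva; apply: nw; exists (a^-1 *: v).
  have := Clin (- a^-1) _ _ Cva C0; rewrite addr0 scalerBr scalerA mulNr mulVf //.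
  by rewrite scaleN1r opprK scaleNr addrC (linearZ_LR f).
apply: (Cmax D).
  split=> [x Cx|DC]; first by exists 0; rewrite scale0r subr0.
  have Cw : C w by apply: DC; exists 1; rewrite scale1r subrr.
  by apply: nw; exists 0; rewrite linear0 subr0.
split=> [b x y [a Ca] [a' Ca']|v [a]].
  exists (b * a + a'); have := Clin b _ _ Ca Ca'.
  by rewrite scalerBr scalerA scalerDl opprD addrACA.
have [->|a0 /(nDw _ _ a0)//] := eqVneq a 0.
by rewrite scale0r subr0; exact: Cf.
Qed.

(** The factor is [g] of a preimage on the image of [f], well defined because
    [g] kills the kernel of [f], and 0 on a complement of that image. *)
Lemma linear_factor (M : lmodType K) (g : {linear V -> M}) :
  (forall v, f v = 0 -> g v = 0) ->
  exists h : {linear W -> M}, forall v, h (f v) = g v.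
Proof.
move=> fg; have [C [Clin Cf /choice[s Cs]]] := image_complement.
have CB x y : C x -> C y -> C (x - y).
  by move=> Cx Cy; rewrite addrC -scaleN1r; exact: Clin.
(* [s w] is a preimage of the component of [w] in the image of [f]; it is unique
   up to the kernel of [f], so [g (s w)] does not depend on its choice. *)
have gs w v : C (w - f v) -> g (s w) = g v.
  move=> Cv; apply/eqP; rewrite -subr_eq0 -linearB; apply/eqP/fg/Cf.
  by have := CB _ _ Cv (Cs w); rewrite opprB addrC addrA subrK -(linearB f).
have lin_gs : linear (g \o s).
  move=> a x y /=; rewrite -linearP; apply: gs.
  by rewrite linearP opprD addrACA -scalerBr; exact: Clin.
pose h : {linear W -> M} := HB.pack (g \o s)
  (GRing.isLinear.Build K W M *:%R (g \o s) lin_gs).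
exists h => v; apply: gs; rewrite subrr -(subrr (f v - f (s (f v)))).
exact: CB.
Qed.

End Factorization.

Section LocalCochains.
Variables (K : fieldType) (X : choiceType) (U : set (set X)).

Lemma cochain_eval_simplex q (xi : cochain K X q) (s : small_simplex U q) :
  cochain_eval xi << s >> = xi s.
Proof. by rewrite /cochain_eval liftU scale1r. Qed.

Lemma chain_boundary_simplex q (s : small_simplex U q.+1) :
  chain_boundary (<< s >> : chain K U q.+1) =
  \sum_(j < q.+2) (-1) ^+ j *: << small_simplex_face j s >>.
Proof. by rewrite /chain_boundary liftU scale1r. Qed.

(** Chains being free on small simplices, a functional on them is evaluation of
    a cochain; the values on the other simplices are immaterial and set to 0. *)
Lemma functional_cochain q (h : chain K U q -> K) :
  exists eta : cochain K X q, forall s : small_simplex U q, eta s = h << s >>.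
Proof.
exists (fun s => if insub s is Some t then h << t >> else 0) => s.
by rewrite valK.
Qed.

Lemma locally_zero_cycles0 (xi : cochain K X 0) :
  (forall c : chain K U 0, cochain_eval xi c = 0) ->
  xi \in @locally_zero K X U 0.
Proof.
move=> xi0; apply/locally_zeroP => s Us.
by rewrite -(cochain_eval_simplex xi (SmallSimplex (introT (asboolP _) Us))) xi0.
Qed.

(** A factorization [xi = h \o boundary] is the equation [xi = coboundary eta]
    tested on small simplices, [eta] being the cochain that represents [h]. *)
Lemma coboundary_of_cycles q (xi : cochain K X q.+1) :
  (forall c : chain K U q.+1, chain_boundary c = 0 -> cochain_eval xi c = 0) ->
  exists eta : cochain K X q,
    cochain_coboundary eta - xi \in @locally_zero K X U q.+1.
Proof.
move=> xi0.
have [h hE] := @linear_factor K _ _ (@chain_boundary K X U q) K^o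
  (cochain_eval xi : chain K U q.+1 -> K^o) xi0.
have [eta etaE] := functional_cochain h.
exists eta; apply/locally_zeroP => s Us.
pose t := SmallSimplex (introT (asboolP _) Us).
apply/eqP; rewrite -[_ == 0]/(cochain_coboundary eta s - xi s == 0) subr_eq0.
rewrite -(cochain_eval_simplex xi t) -hE /= chain_boundary_simplex linear_sum.
by apply/eqP/eq_bigr => j _; rewrite linearZ_LR /= -etaE.
Qed.

End LocalCochains.

Theorem proposition19 (K : fieldType) (X : topologicalType)
    (U : set (set X)) (HU : open_covering U) (q : nat)
    (z : local_cohomology K U q) :
  (forall gamma : small_homology K U q, integral gamma z = 0) -> z = 0.
Proof.
move=> z0; pose x := repr z; pose xi := repr (cycle_val x).
have zE : z = \pi_(local_cohomology K U q) x by rewrite reprK.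
have xE : cycle_val x = \pi_(local_cochain K U q) xi by rewrite reprK.
have xi0 c : chain_out K U q c = 0 -> cochain_eval xi c = 0.
  move=> /eqP cP; rewrite -(integralE (Cycle cP) xE) -zE.
  exact: z0.
rewrite zE -(linear0 \pi_(local_cohomology K U q)).
apply/quotmod_eqP; rewrite subr0; apply/asboolP.
move: (cycle_val x) (xi) xE xi0 => y zeta -> {x zE xi z z0 y}.
case: q zeta => [|q] zeta zeta0.
  exists 0; rewrite linear0 -(linear0 \pi_(local_cochain K U 0)).
  apply/esym/quotmod_eqP; rewrite subr0.
  by apply: locally_zero_cycles0 => c; exact: zeta0.
have [eta etaE] := coboundary_of_cycles zeta0.
exists (\pi_(local_cochain K U q) eta).
by rewrite [LHS]local_coboundary_pi; apply/quotmod_eqP.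
Qed.
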